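(* Let $G$ be a regular Lie group with Lie algebra $\mathfrak g=\mathbf T_eG$. For all $X,Y\in\mathfrak g$ and all $d_1,d_2\in D$, $$\exp\big((d_1+d_2)(X+Y)\big)=\exp\big((d_1+d_2)X\big).\exp\big((d_1+d_2)Y\big).\exp\big(-d_1d_2[X,Y]\big)$$ $$=\exp\big((d_1+d_2)X\big).\exp\big((d_1+d_2)Y\big).\exp\Big(-\frac{(d_1+d_2)^2}{2}[X,Y]\Big).$$
   Context: We work in synthetic differential geometry. $\mathbb R$ is the line: a commutative ring in which positive integers are invertible, satisfying the (general) Kock-Lawvere axiom. $D=\{d\in\mathbb R\mid d^2=0\}$. A space $M$ is microlinear if every finite diagram of infinitesimal spaces that $\mathbb R$ perceives as a colimit is also perceived as a colimit by $M$. A Lie group is a group which is microlinear as a space; its unit is $e$ and its product is written with a dot. $\mathfrak g=\mathbf T_eG$ is the set of maps $X:D\to G$, $d\mapsto X_d$, with $X_0=e$; it is an $\mathbb R$-module with $(\alpha X)_d=X_{\alpha d}$ and $(X+Y)_d=X_d.Y_d=Y_d.X_d$, and a Lie algebra whose bracket $[X,Y]$ is the unique element of $\mathfrak g$ with $X_{d_1}.Y_{d_2}.X_{-d_1}.Y_{-d_2}=[X,Y]_{d_1d_2}$ for all $d_1,d_2\in D$. A Lie group $G$ is regular if for every map $\varsigma:\mathbb R\to\mathfrak g$ there is a map $\theta:\mathbb R\to G$ with $\theta(0)=e$ and $\theta(t+d)=\theta(t).\varsigma(t)_d$ for all $t\in\mathbb R$, $d\in D$. For $X\in\mathfrak g$,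 if $\theta:\mathbb R\to G$ is a one-parameter subgroup (a homomorphism from the additive group of $\mathbb R$) with $\theta(d)=X_d$ for all $d\in D$, then $\exp X$ denotes $\theta(1)$; when $G$ is regular, $\exp:\mathfrak g\to G$ is a total function. *)

(* Defs.v *)
(* Synthetic differential geometry in intuitionistic type theory:
   spaces are types, maps of spaces are functions, and equality of points is
   Leibniz equality.  MathComp's ring structures are unusable for the line:
   they carry a decidable equality, which is incompatible with a nontrivial
   ring satisfying the Kock-Lawvere axiom.  For the same reason the notions
   below are to be read intuitionistically: excluded middle forces 0 = 1 on
   the line.  Function extensionality, propositional extensionality and proof
   irrelevance are harmless, since they hold in every topos. *)
From Stdlib Require Import Ring Ring_theory List ProofIrrelevance.
From Stdlib Require Fin.

Declare Scope sdg_scope.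
Delimit Scope sdg_scope with sdg.
Local Open Scope sdg_scope.

Record cring : Type := CRing {
  cr_car :> Type;
  cr0 : cr_car;
  cr1 : cr_car;
  cr_add : cr_car -> cr_car -> cr_car;
  cr_mul : cr_car -> cr_car -> cr_car;
  cr_sub : cr_car -> cr_car -> cr_car;
  cr_opp : cr_car -> cr_car;
  cr_theory : ring_theory cr0 cr1 cr_add cr_mul cr_sub cr_opp (@eq cr_car)
}.

Arguments cr0 {_}.
Arguments cr1 {_}.
Arguments cr_add {_} _ _.
Arguments cr_mul {_} _ _.
Arguments cr_sub {_} _ _.
Arguments cr_opp {_} _.

Notation "0" := cr0 : sdg_scope.
Notation "1" := cr1 : sdg_scope.
Notation "x + y" := (cr_add x y) : sdg_scope.
Notation "x * y" := (cr_mul x y) : sdg_scope.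
Notation "x - y" := (cr_sub x y) : sdg_scope.
Notation "- x" := (cr_opp x) : sdg_scope.

Definition cr_natr {A : cring} (n : nat) : A :=
  Nat.iter n (fun x : A => x + 1) 0.

Record ring_hom {A B : cring} (f : A -> B) : Prop := RingHom {
  rh_1 : f 1 = 1;
  rh_add : forall x y, f (x + y) = f x + f y;
  rh_mul : forall x y, f (x * y) = f x * f y
}.

(* An [R]-algebra [W] with an augmentation onto [R] whose kernel (the
   augmentation ideal) is nilpotent and is a free [R]-module of finite rank;
   thus [W] is R (+) R^n as a module. *)
Record weil (R : cring) : Type := Weil {
  w_alg :> cring;
  w_scal : R -> w_alg;
  w_scal_hom : ring_hom w_scal;
  w_aug : w_alg -> R;
  w_aug_hom : ring_hom w_aug;
  w_aug_scal : forall r, w_aug (w_scal r) = r;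
  w_rank : nat;
  w_coord : w_alg -> Fin.t w_rank -> R;
  w_coord_add : forall w w' i, w_coord (w + w') i = w_coord w i + w_coord w' i;
  w_coord_scal : forall r w i, w_coord (w_scal r * w) i = r * w_coord w i;
  w_coord_bij : forall v : Fin.t w_rank -> R,
    exists! w : w_alg, w_aug w = 0 /\ forall i, w_coord w i = v i;
  w_nilpotent : exists k : nat, forall s : list w_alg,
    length s = k -> Forall (fun w => w_aug w = 0) s ->
    fold_right cr_mul 1 s = 0
}.

Arguments w_scal {R w0} _.

Record weil_point {R : cring} (W : weil R) (p : W -> R) : Prop := WeilPoint {
  wp_hom : ring_hom p;
  wp_scal : forall r, p (w_scal r) = r
}.

(* The infinitesimal space Spec_R(W) = Hom_{R-alg}(W, R). *)
Definition spec {R : cring} (W : weil R) : Type :=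
  {p : W -> R | weil_point W p}.

(* For every Weil algebra [W], the canonical map W -> R^(Spec_R W), sending
   [w] to evaluation at [w], is a bijection. *)
Definition kock_lawvere (R : cring) : Prop :=
  forall (W : weil R) (f : spec W -> R),
    exists! w : W, forall p : spec W, proj1_sig p w = f p.

Record line : Type := Line {
  line_ring :> cring;
  line_invS : nat -> line_ring;
  line_invSP : forall n, cr_natr (S n) * line_invS n = 1;
  line_kl : kock_lawvere line_ring
}.

(* [line_invS R n] is the inverse of [n + 1]. *)
Definition half {R : line} : R := line_invS R 1.

(* A finite diagram of infinitesimal spaces, indexed by a finite directed
   graph, together with a cocone whose vertex is an infinitesimal space.
   Imposing composition laws on the index would give the same notion, as
   cocones depend only on the generating arrows. *)
Record inf_cocone (R : cring) : Type := InfCocone {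
  ic_nv : nat;
  ic_ne : nat;
  ic_src : Fin.t ic_ne -> Fin.t ic_nv;
  ic_tgt : Fin.t ic_ne -> Fin.t ic_nv;
  ic_obj : Fin.t ic_nv -> weil R;
  ic_arr : forall a, spec (ic_obj (ic_src a)) -> spec (ic_obj (ic_tgt a));
  ic_vertex : weil R;
  ic_leg : forall i, spec (ic_obj i) -> spec ic_vertex;
  ic_comm : forall a x, ic_leg (ic_tgt a) (ic_arr a x) = ic_leg (ic_src a) x
}.

Arguments ic_nv {R} _.
Arguments ic_ne {R} _.
Arguments ic_src {R} _ _.
Arguments ic_tgt {R} _ _.
Arguments ic_obj {R} _ _.
Arguments ic_arr {R} _ _ _.
Arguments ic_vertex {R} _.
Arguments ic_leg {R} _ _ _.

(* The contravariant functor M^(-) turns the cocone into a limit cone. *)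
Definition perceives_colimit {R : cring} (M : Type) (C : inf_cocone R) : Prop :=
  forall phi : (forall i, spec (ic_obj C i) -> M),
    (forall a x, phi (ic_tgt C a) (ic_arr C a x) = phi (ic_src C a) x) ->
    exists! psi : spec (ic_vertex C) -> M,
      forall i x, psi (ic_leg C i x) = phi i x.

Definition microlinear (R : line) (M : Type) : Prop :=
  forall C : inf_cocone R, perceives_colimit R C -> perceives_colimit M C.

Definition D (R : cring) : Type := {d : R | d * d = 0}.

Definition D_val {R : cring} (d : D R) : R := proj1_sig d.
Coercion D_val : D >-> cr_car.

Section DOperations.
Context {R : cring}.
Add Ring cring_ring : (cr_theory R).

Lemma D0_subproof : (0 : R) * 0 = 0.
Proof. ring. Qed.

Lemma D_scale_subproof (a : R) (d : D R) : (a * d) * (a * d) = 0.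
Proof.
  destruct d as [d Hd]; simpl.
  replace (a * d * (a * d)) with (a * a * (d * d)) by ring.
  rewrite Hd; ring.
Qed.

Lemma D_opp_subproof (d : D R) : (- d) * (- d) = 0.
Proof.
  destruct d as [d Hd]; simpl.
  replace (- d * - d) with (d * d) by ring; exact Hd.
Qed.

Definition D0 : D R := exist _ 0 D0_subproof.
Definition D_scale (a : R) (d : D R) : D R :=
  exist _ (a * d) (D_scale_subproof a d).
Definition D_opp (d : D R) : D R := exist _ (- d) (D_opp_subproof d).

Lemma D_ext (d d' : D R) : (d : R) = d' -> d = d'.
Proof.
  destruct d as [d p], d' as [d' q]; simpl; intros E; subst d'.
  f_equal; apply proof_irrelevance.
Qed.

Lemma D_scale0 (a : R) : D_scale a D0 = D0.
Proof. apply D_ext; simpl; ring. Qed.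

End DOperations.

Record lie_group (R : line) : Type := LieGroup {
  lg_car :> Type;
  lg_e : lg_car;
  lg_mul : lg_car -> lg_car -> lg_car;
  lg_inv : lg_car -> lg_car;
  lg_assoc : forall x y z, lg_mul x (lg_mul y z) = lg_mul (lg_mul x y) z;
  lg_mul_e_l : forall x, lg_mul lg_e x = x;
  lg_mul_inv_l : forall x, lg_mul (lg_inv x) x = lg_e;
  lg_mul_e_r : forall x, lg_mul x lg_e = x;
  lg_mul_inv_r : forall x, lg_mul x (lg_inv x) = lg_e;
  lg_microlinear : microlinear R lg_car
}.

Arguments lg_e {R l}.
Arguments lg_mul {R l} _ _.
Arguments lg_inv {R l} _.

Notation "g @* h" := (lg_mul g h)
  (at level 40, left associativity) : sdg_scope.

Record lie_alg {R : line} (G : lie_group R) : Type := Tangent {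
  tan_fun :> D R -> G;
  tan_0 : tan_fun D0 = lg_e
}.

Arguments Tangent {R G} _ _.
Arguments tan_0 {R G} _.

Section LieTheory.
Context {R : line} {G : lie_group R}.

Lemma tan_scale_subproof (a : R) (X : lie_alg G) : X (D_scale a D0) = lg_e.
Proof. rewrite D_scale0; apply tan_0. Qed.

Lemma tan_add_subproof (X Y : lie_alg G) : X D0 @* Y D0 = lg_e.
Proof. rewrite !tan_0; apply lg_mul_e_l. Qed.

Definition tan_scale (a : R) (X : lie_alg G) : lie_alg G :=
  Tangent (fun d => X (D_scale a d)) (tan_scale_subproof a X).

Definition tan_add (X Y : lie_alg G) : lie_alg G :=
  Tangent (fun d => X d @* Y d) (tan_add_subproof X Y).

(* [D_scale d1 d2] is the product d1 d2 as an element of [D]. *)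
Definition is_bracket (X Y Z : lie_alg G) : Prop :=
  forall d1 d2 : D R,
    X d1 @* Y d2 @* X (D_opp d1) @* Y (D_opp d2) = Z (D_scale d1 d2).

Definition one_parameter_subgroup (theta : R -> G) : Prop :=
  forall s t : R, theta (s + t) = theta s @* theta t.

Definition is_exp (X : lie_alg G) (g : G) : Prop :=
  exists theta : R -> G,
    one_parameter_subgroup theta /\ (forall d : D R, theta d = X d) /\
    theta 1 = g.

(* [ex] is the total function with graph [is_exp].  It is specified rather than
   constructed: that theta(1) does not depend on theta cannot be derived from
   the Kock-Lawvere axiom alone. *)
Definition exponential (ex : lie_alg G -> G) : Prop :=
  forall (X : lie_alg G) (g : G), ex X = g <-> is_exp X g.

End LieTheory.

Notation "a *: X" := (tan_scale a X) (at level 40) : sdg_scope.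
Notation "X +: Y" := (tan_add X Y)
  (at level 50, left associativity) : sdg_scope.

Definition regular {R : line} (G : lie_group R) : Prop :=
  forall sigma : R -> lie_alg G,
    exists theta : R -> G,
      theta 0 = lg_e /\
      forall (t : R) (d : D R), theta (t + d) = theta t @* sigma t d.

(* Main.v *)
(** The one-parameter subgroup of [X] takes the value [X_d] at [d], so that
    exp((d1 + d2) X) = X_{d1}.X_{d2}; all three factors of the formula become
    products of tangent vectors, and the formula reduces to exchanging Y_{d1}
    and X_{d2}.  This costs the commutator [X,Y]_{-d1d2}, which commutes with
    everything in sight since brackets vanish at d1.d1d2 = 0 and d2.d1d2 = 0.
    The bracket itself exists because multiplication D x D -> D is, as far as
    the line (hence the group) can see, the quotient of D x D that collapses
    the two axes: a map a + b d1 + c d2 + e d1d2 is constant on the axes iff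
    b = c = 0. *)
Require Import Defs.
From Stdlib Require Import Ring ProofIrrelevance FunctionalExtensionality.
From Stdlib Require Fin.
Local Open Scope sdg_scope.

(** * Dual numbers over a commutative ring *)

Section Dual.
Context (A : cring).
Add Ring dual_base_ring : (cr_theory A).

(** The pair [(a, b)] stands for a + b eps with eps^2 = 0. *)
Lemma dual_theory : ring_theory (0, 0) (1, 0)
  (fun u v : A * A => (fst u + fst v, snd u + snd v))
  (fun u v => (fst u * fst v, fst u * snd v + snd u * fst v))
  (fun u v => (fst u - fst v, snd u - snd v))
  (fun u => (- fst u, - snd u)) eq.
Proof.
  constructor; intros; repeat match goal with u : (_ * _)%type |- _ => destruct u end;
    simpl; f_equal; ring.
Qed.

Definition dual : cring := CRing _ _ _ _ _ _ _ dual_theory.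

Lemma dual_scal_hom : ring_hom (fun a : A => (a, 0) : dual).
Proof. constructor; intros; simpl; f_equal; ring. Qed.

Lemma dual_aug_hom : ring_hom (fun u : dual => fst u).
Proof. constructor; reflexivity. Qed.

End Dual.

Lemma ring_hom_comp {A B C : cring} (f : A -> B) (g : B -> C) :
  ring_hom f -> ring_hom g -> ring_hom (fun x => g (f x)).
Proof.
  intros [f1 fD fM] [g1 gD gM]; constructor; intros.
  - rewrite f1; exact g1.
  - rewrite fD; apply gD.
  - rewrite fM; apply gM.
Qed.

(** * Weil algebras of D and D x D, their points, and the collapsing cocone *)

Section WeilAlgebras.
Context (R : cring).
Add Ring weil_base_ring : (cr_theory R).

Definition weilD : weil R.
Proof.
  refine (Weil R (dual R) (fun r => (r, 0)) (dual_scal_hom R)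
    (fun w => fst w) (dual_aug_hom R) _ 1 (fun w _ => snd w) _ _ _ _).
  - reflexivity.
  - reflexivity.
  - intros r [a b] i; simpl; ring.
  - intros v; exists (0, v Fin.F1); split.
    + split; [reflexivity|].
      intros i; apply (Fin.caseS' i); [reflexivity|]; apply Fin.case0.
    + intros [a b] [Ha Hb]; simpl in *; subst a; rewrite (Hb Fin.F1); reflexivity.
  - exists 2; intros s Hs Hall.
    destruct s as [|[a b] [|[a' b'] [|? ?]]]; try discriminate Hs.
    inversion Hall as [|? ? Ha Hall']; inversion Hall' as [|? ? Ha' _].
    simpl in *; subst a a'; f_equal; ring.
Defined.

(** [((a, b), (c, e))] stands for a + b x + c y + e xy in R[x,y]/(x^2,y^2). *)
Definition weilDD : weil R.
Proof.
  refine (Weil R (dual (dual R)) (fun r => ((r, 0), (0, 0)))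
    (ring_hom_comp _ _ (dual_scal_hom R) (dual_scal_hom (dual R)))
    (fun w => fst (fst w))
    (ring_hom_comp _ _ (dual_aug_hom (dual R)) (dual_aug_hom R)) _ 3
    (fun w i => Fin.caseS' i (fun _ => cr_car R) (snd (fst w))
      (fun j => Fin.caseS' j (fun _ => cr_car R) (fst (snd w))
        (fun _ => snd (snd w)))) _ _ _ _).
  - reflexivity.
  - intros w w' i; apply (Fin.caseS' i); [reflexivity|]; intros j.
    apply (Fin.caseS' j); reflexivity.
  - intros r [[a b] [c e]] i.
    apply (Fin.caseS' i); [simpl; ring|]; intros j.
    apply (Fin.caseS' j); intros; simpl; ring.
  - intros v.
    exists ((0, v Fin.F1), (v (Fin.FS Fin.F1), v (Fin.FS (Fin.FS Fin.F1)))); split.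
    + split; [reflexivity|].
      intros i; apply (Fin.caseS' i); [reflexivity|]; intros j.
      apply (Fin.caseS' j); [reflexivity|]; intros k.
      apply (Fin.caseS' k); [reflexivity|]; apply Fin.case0.
    + intros [[a b] [c e]] [Ha Hv]; simpl in Ha; subst a.
      rewrite <- !Hv; reflexivity.
  (* A product of two elements of the augmentation ideal is a multiple of xy; a third factor kills
     it. *)
  - exists 3; intros s Hs Hall.
    destruct s as [|[[a b] [c e]] [|[[a' b'] [c' e']] [|[[a2 b2] [c2 e2]] [|? ?]]]];
      try discriminate Hs.
    inversion Hall as [|? ? Ha Hall']; inversion Hall' as [|? ? Ha' Hall2].
    inversion Hall2 as [|? ? Ha2 _].
    simpl in *; subst a a' a2; f_equal; f_equal; ring.
Defined.

Lemma spec_ext {W : weil R} (p q : spec W) :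
  (forall w, proj1_sig p w = proj1_sig q w) -> p = q.
Proof.
  destruct p as [p Hp], q as [q Hq]; simpl; intros E.
  assert (p = q) by (apply functional_extensionality; exact E); subst q.
  f_equal; apply proof_irrelevance.
Qed.

Lemma D_sq (d : D R) : d * d = 0.
Proof. exact (proj2_sig d). Qed.

Lemma D_opp_scale_mul_l (d1 d2 : D R) : D_opp (D_scale d1 d2) * d1 = 0.
Proof.
  simpl; transitivity (- ((d1 * d1) * d2)); [|rewrite D_sq]; ring.
Qed.

Lemma D_opp_scale_mul_r (d1 d2 : D R) : D_opp (D_scale d1 d2) * d2 = 0.
Proof.
  simpl; transitivity (- (d1 * (d2 * d2))); [|rewrite D_sq]; ring.
Qed.

Lemma pointD_subproof (d : D R) :
  weil_point weilD (fun w => fst w + snd w * d).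
Proof.
  pose proof (D_sq d) as Hd.
  split; [split|]; simpl; intros.
  - ring.
  - ring.
  - transitivity (fst x * fst y + (fst x * snd y + snd x * fst y) * d
                  + snd x * snd y * (d * d)); [rewrite Hd|]; ring.
  - ring.
Qed.

Definition pointD (d : D R) : spec weilD := exist _ _ (pointD_subproof d).

Lemma pointDD_subproof (d1 d2 : D R) :
  weil_point weilDD (fun w => fst (fst w) + snd (fst w) * d1
    + fst (snd w) * d2 + snd (snd w) * (d1 * d2)).
Proof.
  pose proof (D_sq d1) as H1; pose proof (D_sq d2) as H2.
  split; [split|]; simpl; intros; try ring.
  destruct x as [[a b] [c e]], y as [[a' b'] [c' e']]; simpl.
  (* The product of the values differs from the value of the product only by terms containing d1^2
     or d2^2. *)
  transitivity ((a + b * d1 + c * d2 + e * (d1 * d2))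
      * (a' + b' * d1 + c' * d2 + e' * (d1 * d2))
    - (d1 * d1) * (b * b' + (b * e' + e * b') * d2)
    - (d2 * d2) * (c * c' + (c * e' + e * c') * d1)
    - (d1 * d1) * (d2 * d2) * (e * e')); [|rewrite H1, H2]; ring.
Qed.

Definition pointDD (d1 d2 : D R) : spec weilDD :=
  exist _ _ (pointDD_subproof d1 d2).

Lemma spec_sq0 {W : weil R} (p : spec W) (w : W) :
  w * w = 0 -> proj1_sig p w * proj1_sig p w = 0.
Proof.
  destruct p as [p [[p1 pD pM] pS]]; simpl; intros E.
  rewrite <- pM, E.
  (* [ring_hom] does not list preservation of 0; it follows from additivity by cancellation. *)
  assert (p 0 + p 0 = p 0) as E0.
  { rewrite <- pD; f_equal; apply (Radd_0_l (cr_theory W)). }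
  transitivity (p 0 + p 0 - p 0); [|rewrite E0]; ring.
Qed.

Lemma weilD_eps_sq : ((0, 1) : weilD) * (0, 1) = 0.
Proof. simpl; f_equal; ring. Qed.

Lemma weilDD_x_sq : (((0, 1), (0, 0)) : weilDD) * ((0, 1), (0, 0)) = 0.
Proof. simpl; repeat f_equal; ring. Qed.

Lemma weilDD_y_sq : (((0, 0), (1, 0)) : weilDD) * ((0, 0), (1, 0)) = 0.
Proof. simpl; repeat f_equal; ring. Qed.

(** Coordinates of a point are its values at the generators eps, x and y, which square to zero. *)
Definition coordD (p : spec weilD) : D R :=
  exist _ _ (spec_sq0 p _ weilD_eps_sq).
Definition coordDx (p : spec weilDD) : D R :=
  exist _ _ (spec_sq0 p _ weilDD_x_sq).
Definition coordDy (p : spec weilDD) : D R :=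
  exist _ _ (spec_sq0 p _ weilDD_y_sq).

Lemma pointDK (d : D R) : coordD (pointD d) = d.
Proof. apply D_ext; simpl; ring. Qed.

(** A point is an algebra map, so its values at x and y determine it. *)
Lemma coordDDK (p : spec weilDD) : pointDD (coordDx p) (coordDy p) = p.
Proof.
  apply spec_ext; intros [[a b] [c e]]; destruct p as [p [[p1 pD pM] pS]]; simpl.
  transitivity (p (w_scal a) + p (w_scal b) * p ((0, 1), (0, 0))
    + p (w_scal c) * p ((0, 0), (1, 0))
    + p (w_scal e) * (p ((0, 1), (0, 0)) * p ((0, 0), (1, 0)))).
  - rewrite !pS; reflexivity.
  - rewrite <- !pM, <- !pD; f_equal; simpl; f_equal; f_equal; ring.
Qed.

Lemma pointDDKx (d1 d2 : D R) : coordDx (pointDD d1 d2) = d1.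
Proof. apply D_ext; simpl; ring. Qed.

Lemma pointDDKy (d1 d2 : D R) : coordDy (pointDD d1 d2) = d2.
Proof. apply D_ext; simpl; ring. Qed.

Lemma D_scale_0l (d : D R) : D_scale 0 d = D0.
Proof. apply D_ext; simpl; ring. Qed.

(** The diagram has three arrows from [D x D] (vertex 0) to [D x D] (vertex 1):
    the projections onto the two axes and onto the origin. *)
Definition collapse_arr (a : Fin.t 3) (p : spec weilDD) : spec weilDD :=
  Fin.caseS' a (fun _ => spec weilDD) (pointDD (coordDx p) D0)
    (fun b => Fin.caseS' b (fun _ => spec weilDD) (pointDD D0 (coordDy p))
      (fun _ => pointDD D0 D0)).

(** The leg at vertex 1 is multiplication; commutation with the arrows then forces the leg at vertex
    0 to be constantly 0. *)
Definition collapse_leg (i : Fin.t 2) (p : spec weilDD) : spec weilD :=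
  Fin.caseS' i (fun _ => spec weilD) (pointD D0)
    (fun _ => pointD (D_scale (coordDx p) (coordDy p))).

Lemma collapse_leg_pointDD (d1 d2 : D R) :
  collapse_leg (Fin.FS Fin.F1) (pointDD d1 d2) = pointD (D_scale d1 d2).
Proof.
  unfold collapse_leg; cbv beta iota delta [Fin.caseS'].
  rewrite pointDDKx, pointDDKy; reflexivity.
Qed.

Lemma collapse_comm (a : Fin.t 3) (p : spec weilDD) :
  collapse_leg (Fin.FS Fin.F1) (collapse_arr a p) = collapse_leg Fin.F1 p.
Proof.
  apply (Fin.caseS' a); [|intros b; apply (Fin.caseS' b); [|intros c]];
    unfold collapse_arr; cbv beta iota delta [Fin.caseS'];
    rewrite collapse_leg_pointDD; unfold collapse_leg; simpl; f_equal;
    auto using D_scale0, D_scale_0l.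
Qed.

Definition collapse_axes : inf_cocone R :=
  InfCocone R 2 3 (fun _ => Fin.F1) (fun _ => Fin.FS Fin.F1) (fun _ => weilDD)
    collapse_arr weilD collapse_leg collapse_comm.

End WeilAlgebras.

(** * Kock-Lawvere and factorization through multiplication *)

Section Multiplication.
Context (R : line).
Add Ring line_base_ring : (cr_theory R).

(** This is the uniqueness half of Kock-Lawvere for [weilDD], since every point has the form
    [pointDD d1 d2]. *)
Lemma polyDD_inj (a b c e a' b' c' e' : R) :
  (forall d1 d2 : D R, a + b * d1 + c * d2 + e * (d1 * d2)
    = a' + b' * d1 + c' * d2 + e' * (d1 * d2)) ->
  a = a' /\ b = b' /\ c = c' /\ e = e'.
Proof.
  intros E.
  destruct (line_kl R (weilDD R)
    (fun p => proj1_sig p ((a, b), (c, e)))) as [w [_ Hw]].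
  assert (w = ((a, b), (c, e))) as Hl by (apply Hw; reflexivity).
  assert (w = ((a', b'), (c', e'))) as Hr.
  { apply Hw; intros p; rewrite <- (coordDDK R p); symmetry; exact (E _ _). }
  rewrite Hl in Hr; injection Hr; auto.
Qed.

Lemma line_perceives_collapse_axes : perceives_colimit R (collapse_axes R).
Proof.
  intros phi Hphi; simpl in phi, Hphi.
  set (f := phi (Fin.FS Fin.F1)).
  destruct (line_kl R (weilDD R) f) as [[[a b] [c e]] [Hf _]].
  assert (forall d1 d2 : D R,
    f (pointDD R d1 d2) = a + b * d1 + c * d2 + e * (d1 * d2)) as Ef
    by (intros; symmetry; exact (Hf (pointDD R d1 d2))).
  pose proof (Hphi (Fin.FS (Fin.FS Fin.F1))) as H0.
  pose proof (Hphi (Fin.FS Fin.F1)) as Hy.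
  pose proof (Hphi Fin.F1) as Hx.
  change (forall p, f (pointDD R D0 D0) = phi Fin.F1 p) in H0.
  change (forall p, f (pointDD R D0 (coordDy R p)) = phi Fin.F1 p) in Hy.
  change (forall p, f (pointDD R (coordDx R p) D0) = phi Fin.F1 p) in Hx.
  (* On the first axis a + b d1 equals the value a at the origin for every d1; compare
     coefficients. *)
  assert (b = 0) as Hb.
  { refine (proj1 (proj2 (polyDD_inj a b 0 0 a 0 0 0 _))); intros d1 d2.
    pose proof (Hx (pointDD R d1 d2)) as E; rewrite <- H0, pointDDKx, !Ef in E.
    simpl in E; ring_simplify in E; ring_simplify; exact E. }
  assert (c = 0) as Hc.
  { refine (proj1 (proj2 (proj2 (polyDD_inj a 0 c 0 a 0 0 0 _)))); intros d1 d2.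
    pose proof (Hy (pointDD R d1 d2)) as E; rewrite <- H0, pointDDKy, !Ef in E.
    simpl in E; ring_simplify in E; ring_simplify; exact E. }
  subst b c.
  (* What remains is a + e d1d2, the value at d1d2 of the affine map given by a + e eps. *)
  exists (fun p => proj1_sig p (a, e)); split.
  - intros i; apply (Fin.caseS' i).
    + intros p; change (a + e * 0 = phi Fin.F1 p).
      rewrite <- (H0 p), Ef; simpl; ring.
    + intros j; apply (Fin.caseS' j); [|intros k; inversion k].
      intros p; change (a + e * (coordDx R p * coordDy R p) = f p).
      rewrite <- (coordDDK R p) at 3; rewrite Ef; ring.
  - intros psi Hpsi.
    (* A competing [psi] is affine too, and its composite with multiplication determines both
       coefficients. *)
    destruct (line_kl R (weilD R) psi) as [[a' e'] [Hw _]].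
    destruct (polyDD_inj a 0 0 e a' 0 0 e') as [-> [_ [_ ->]]].
    { intros d1 d2; rewrite <- Ef.
      pose proof (Hpsi (Fin.FS Fin.F1) (pointDD R d1 d2)) as E.
      change (psi (collapse_leg R (Fin.FS Fin.F1) (pointDD R d1 d2))
        = f (pointDD R d1 d2)) in E.
      rewrite <- E, collapse_leg_pointDD, <- Hw; simpl; ring. }
    apply functional_extensionality; exact Hw.
Qed.

(** Microlinearity carries the colimit property from the line to [M]; the rest translates between
    points of Weil algebras and [D]. *)
Lemma microlinear_factor_mult (M : Type) (f : D R -> D R -> M) (m : M) :
  microlinear R M ->
  (forall d, f d D0 = m) -> (forall d, f D0 d = m) ->
  exists! g : D R -> M, forall d1 d2 : D R, g (D_scale d1 d2) = f d1 d2.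
Proof.
  intros HM fx fy.
  set (phi := fun (i : Fin.t 2) (p : spec (weilDD R)) =>
    Fin.caseS' i (fun _ => M) m (fun _ => f (coordDx R p) (coordDy R p))).
  destruct (HM _ line_perceives_collapse_axes phi) as [psi [Hpsi Hu]].
  { intros a p; simpl in a.
    apply (Fin.caseS' a); [|intros b; apply (Fin.caseS' b); [|intros c]];
      unfold phi; cbv beta iota delta [Fin.caseS' ic_tgt ic_src ic_arr collapse_axes
        collapse_arr];
      rewrite ?pointDDKx, ?pointDDKy; auto. }
  exists (fun d => psi (pointD R d)); split.
  - intros d1 d2.
    pose proof (Hpsi (Fin.FS Fin.F1) (pointDD R d1 d2)) as E.
    change (psi (collapse_leg R (Fin.FS Fin.F1) (pointDD R d1 d2))
      = f (coordDx R (pointDD R d1 d2)) (coordDy R (pointDD R d1 d2))) in E.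
    rewrite collapse_leg_pointDD, pointDDKx, pointDDKy in E; exact E.
  - intros g Hg.
    assert (psi = fun p => g (coordD R p)) as ->.
    { apply Hu; intros i; apply (Fin.caseS' i).
      - intros p; change (g (coordD R (pointD R D0)) = m).
        rewrite pointDK, <- (D_scale0 D0), Hg; apply fx.
      - intros j; apply (Fin.caseS' j); [|intros k; inversion k].
        intros p.
        change (g (coordD R (pointD R (D_scale (coordDx R p) (coordDy R p))))
          = f (coordDx R p) (coordDy R p)).
        rewrite pointDK; apply Hg. }
    apply functional_extensionality; intros d; rewrite pointDK; reflexivity.
Qed.

End Multiplication.

(** * Existence of brackets and commutation of tangent vectors *)

Section Brackets.
Context {R : line} {G : lie_group R}.
Add Ring bracket_base_ring : (cr_theory R).

Lemma tan_ext (X Y : lie_alg G) : (forall d, X d = Y d) -> X = Y.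
Proof.
  destruct X as [X HX], Y as [Y HY]; simpl; intros E.
  assert (X = Y) by (apply functional_extensionality; exact E); subst Y.
  f_equal; apply proof_irrelevance.
Qed.

(** On the axes the commutator reduces to X_d.X_{-d} or Y_d.Y_{-d}, which the hypotheses make
    trivial, so it factors through d1d2. *)
Lemma is_bracket_exists (X Y : lie_alg G) :
  (forall d, X d @* X (D_opp d) = lg_e) ->
  (forall d, Y d @* Y (D_opp d) = lg_e) ->
  exists Z, unique (is_bracket X Y) Z.
Proof.
  intros HX HY.
  assert (D_opp D0 = D0 :> D R) as ED by (apply D_ext; simpl; ring).
  destruct (microlinear_factor_mult R G
    (fun d1 d2 => X d1 @* Y d2 @* X (D_opp d1) @* Y (D_opp d2)) lg_e)
    as [g [Hg Hu]].
  - apply lg_microlinear.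
  - intros d; rewrite ED, tan_0, !lg_mul_e_r; apply HX.
  - intros d; rewrite ED, tan_0, lg_mul_e_r, lg_mul_e_l; apply HY.
  - assert (g D0 = lg_e) as g0.
    { rewrite <- (D_scale0 (@D0 R)) at 1; rewrite Hg, ED, !tan_0, !lg_mul_e_r.
      reflexivity. }
    exists (Tangent g g0); split.
    + intros d1 d2; symmetry; apply Hg.
    + intros Z HZ; apply tan_ext; intros d; simpl.
      rewrite (Hu (tan_fun _ Z)); [reflexivity|].
      intros d1 d2; symmetry; apply HZ.
Qed.

Lemma is_bracket_swap (X Y Z : lie_alg G) (d1 d2 : D R) :
  (forall d, X (D_opp d) @* X d = lg_e) ->
  (forall d, Y (D_opp d) @* Y d = lg_e) ->
  is_bracket X Y Z ->
  X d1 @* Y d2 = Z (D_scale d1 d2) @* Y d2 @* X d1.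
Proof.
  intros HX HY HZ; rewrite <- HZ, <- !lg_assoc.
  rewrite (lg_assoc _ _ (Y (D_opp d2))), HY, lg_mul_e_l, HX, lg_mul_e_r.
  reflexivity.
Qed.

(** The obstruction to commuting is [X,Y]_{d1d2}, here evaluated at 0. *)
Lemma tan_commute (X Y : lie_alg G) (d1 d2 : D R) :
  (forall Z : lie_alg G, forall d, Z d @* Z (D_opp d) = lg_e) ->
  (forall Z : lie_alg G, forall d, Z (D_opp d) @* Z d = lg_e) ->
  d1 * d2 = 0 -> X d1 @* Y d2 = Y d2 @* X d1.
Proof.
  intros Hr Hl E.
  destruct (is_bracket_exists X Y (Hr X) (Hr Y)) as [Z [HZ _]].
  rewrite (is_bracket_swap X Y Z) by auto.
  assert (D_scale d1 d2 = D0) as -> by (apply D_ext; exact E).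
  rewrite tan_0, lg_mul_e_l; reflexivity.
Qed.

End Brackets.

(** * Exponentials as values of one-parameter subgroups *)

Section Exponential.
Context {R : line} {G : lie_group R} (exp : lie_alg G -> G).
Context (exp_def : exponential exp).
Add Ring exp_base_ring : (cr_theory R).

(** If theta is the subgroup of [X], then t -> theta(a t) is a subgroup for [a *: X], with value
    theta(a) at 1. *)
Lemma exp_flow (X : lie_alg G) :
  exists theta : R -> G, one_parameter_subgroup theta /\
    (forall d : D R, theta d = X d) /\ forall a, exp (a *: X) = theta a.
Proof.
  destruct (proj1 (exp_def X (exp X)) eq_refl) as [theta [Hth [HX _]]].
  exists theta; split; [exact Hth|]; split; [exact HX|].
  intros a; apply exp_def; exists (fun t => theta (a * t)); split; [|split].
  - intros s t; rewrite <- Hth; f_equal; ring.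
  - intros d; exact (HX (D_scale a d)).
  - f_equal; ring.
Qed.

Lemma exp_tan (X : lie_alg G) (d : D R) : exp (d *: X) = X d.
Proof.
  destruct (exp_flow X) as [theta [_ [HX Hexp]]]; rewrite Hexp; apply HX.
Qed.

(** Since d1 + d2 need not lie in [D], [X] cannot be evaluated there; the homomorphism theta splits
    the sum. *)
Lemma exp_tan_add (X : lie_alg G) (d1 d2 : D R) :
  exp ((d1 + d2) *: X) = X d1 @* X d2.
Proof.
  destruct (exp_flow X) as [theta [Hth [HX Hexp]]].
  rewrite Hexp, Hth, !HX; reflexivity.
Qed.

Lemma tan_mul_eq0 (X : lie_alg G) (d1 d2 : D R) :
  d1 + d2 = 0 -> X d1 @* X d2 = lg_e.
Proof.
  intros E; destruct (exp_flow X) as [theta [Hth [HX _]]].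
  rewrite <- !HX, <- Hth, E, <- (tan_0 X), <- HX; reflexivity.
Qed.

Lemma tan_oppr (X : lie_alg G) (d : D R) : X d @* X (D_opp d) = lg_e.
Proof. apply tan_mul_eq0; simpl; ring. Qed.

Lemma tan_oppl (X : lie_alg G) (d : D R) : X (D_opp d) @* X d = lg_e.
Proof. apply tan_mul_eq0; simpl; ring. Qed.

Lemma tan_swap (X Y Z : lie_alg G) (d1 d2 : D R) :
  is_bracket X Y Z ->
  Y d1 @* X d2 = X d2 @* Y d1 @* Z (D_opp (D_scale d1 d2)).
Proof.
  intros HZ.
  assert (X d2 @* Y d1 = Z (D_scale d1 d2) @* (Y d1 @* X d2)) as ->.
  { rewrite (is_bracket_swap X Y Z d2 d1) by auto using tan_oppl.
    rewrite <- lg_assoc; f_equal; f_equal; apply D_ext; simpl; ring. }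
  rewrite <- !lg_assoc.
  (* Carry the factor Z_{-d1d2} leftwards past X_{d2}, then past Y_{d1}, until it cancels
     Z_{d1d2}. *)
  rewrite <- (tan_commute Z X (D_opp (D_scale d1 d2)) d2) by
    auto using tan_oppl, tan_oppr, D_opp_scale_mul_r.
  rewrite (lg_assoc _ _ (Y d1)).
  rewrite <- (tan_commute Z Y (D_opp (D_scale d1 d2)) d1) by
    auto using tan_oppl, tan_oppr, D_opp_scale_mul_l.
  rewrite !lg_assoc, tan_oppr, lg_mul_e_l; reflexivity.
Qed.

End Exponential.

(** * The scalar identity between the two forms of the correction *)

Section Half.
Context {R : line}.
Add Ring half_base_ring : (cr_theory R).

Lemma D_add_sqr_half (d1 d2 : D R) :
  (d1 + d2) * (d1 + d2) * half = d1 * d2.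
Proof.
  pose proof (D_sq R d1) as H1; pose proof (D_sq R d2) as H2.
  pose proof (line_invSP R 1) as Hh; fold (@half R) in Hh; simpl in Hh.
  (* The number 2 appears as 0 + 1 + 1, the unfolding of [cr_natr]. *)
  transitivity ((d1 * d1 + d2 * d2) * half + d1 * d2 * ((0 + 1 + 1) * half));
    [ring|].
  rewrite H1, H2; change ((0 + 1 + 1) * half = (1 : R)) in Hh; rewrite Hh; ring.
Qed.

End Half.

Theorem theorem34 (R : line) (G : lie_group R) (Greg : regular G)
    (exp : lie_alg G -> G) (exp_def : exponential exp) (X Y : lie_alg G) :
  exists XY : lie_alg G,
    unique (is_bracket X Y) XY /\
    forall d1 d2 : D R,
      exp ((d1 + d2) *: (X +: Y)) =
        exp ((d1 + d2) *: X) @* exp ((d1 + d2) *: Y) @* exp (- (d1 * d2) *: XY)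
      /\
      exp ((d1 + d2) *: X) @* exp ((d1 + d2) *: Y) @* exp (- (d1 * d2) *: XY) =
        exp ((d1 + d2) *: X) @* exp ((d1 + d2) *: Y) @*
        exp (- ((d1 + d2) * (d1 + d2) * half) *: XY).
Proof.
  destruct (is_bracket_exists X Y) as [Z HZ];
    try (intros; apply (tan_oppr exp exp_def)).
  exists Z; split; [exact HZ|]; destruct HZ as [HZ _]; intros d1 d2.
  split; [|rewrite D_add_sqr_half; reflexivity].
  rewrite !(exp_tan_add exp exp_def).
  change (- (d1 * d2)) with (D_val (D_opp (D_scale d1 d2))).
  rewrite (exp_tan exp exp_def); simpl.
  rewrite <- !lg_assoc; f_equal.
  (* With X_{d1} cancelled, the exchange leaves the bracket factor before Y_{d2}; the two commute
     because d1d2.d2 = 0. *)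
  rewrite (lg_assoc _ _ (Y d1)), (tan_swap exp exp_def X Y Z) by exact HZ.
  rewrite <- !lg_assoc; do 2 f_equal.
  apply tan_commute; eauto using tan_oppl, tan_oppr.
  apply D_opp_scale_mul_r.
Qed.
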